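(* Let $W_2$ be the configuration in $Q_3$ consisting of two vertices at Hamming distance $2$, i.e. (up to exact copy) $W_2=\{000,110\}$. Then the $3$-cube density of $W_2$ is $$\lambda(W_2,3)=\frac{3}{4}.$$
   Context: The $n$-cube $Q_n$ is the graph with vertex set $V_n=\{0,1\}^n$, two vertices being adjacent iff they differ in exactly one coordinate. A configuration in $Q_n$ is a subset of $V_n$. For configurations $H,K$ in $Q_d$, $K$ is an exact copy of $H$ if some graph automorphism of $Q_d$ maps $H$ onto $K$. For $1\le d\le n$, a sub-$d$-cube $R$ of $Q_n$ is obtained by letting $d$ coordinates vary and fixing the other $n-d$ coordinates; there are $\binom{n}{d}2^{n-d}$ of them, and each is identified with $Q_d$ through its $d$ varying coordinates, so it makes sense to ask whether $S\cap R$ is an exact copy of $H$. For a configuration $H$ in $Q_d$ and $S\subseteq V_n$, let $g(H,d,n,S)$ be the number of sub-$d$-cubes $R$ of $Q_n$ such that $S\cap R$ is an exact copy of $H$, divided by $\binom{n}{d}2^{n-d}$. Let $\lambda(H,d,n)=\max_{S\subseteq V_n} g(H,d,n,S)$. This is nonincreasing in $n$, and the $d$-cube density of $H$ is $\lambda(H,d)=\lim_{n\to\infty}\lambda(H,d,n)$. *)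

(* Defs.v *)
From HB Require Import structures.
From mathcomp Require Import all_boot all_order all_fingroup all_algebra.
From mathcomp Require Import all_classical all_reals all_analysis.

Set Implicit Arguments.
Unset Strict Implicit.
Unset Printing Implicit Defensive.

Import Order.TTheory GRing.Theory Num.Theory.
Import numFieldNormedType.Exports.

Local Open Scope ring_scope.

Definition vertex (n : nat) := {ffun 'I_n -> bool}.

Definition configuration (n : nat) := {set vertex n}.

Definition hamming (n : nat) (x y : vertex n) : nat :=
  #|[set i | x i != y i]|.

Definition cube_adj (n : nat) (x y : vertex n) : bool := hamming x y == 1%N.

Definition cube_aut (n : nat) (f : {perm vertex n}) : bool :=
  [forall x, forall y, cube_adj (f x) (f y) == cube_adj x y].

Definition exact_copy (d : nat) (H K : configuration d) : bool :=
  [exists f : {perm vertex d}, cube_aut f && (f @: H == K)].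

(* A sub-d-cube is encoded by the increasing list [c.1] of its varying
   coordinates together with the values [c.2] of its fixed coordinates. The
   entries of [c.2] at the varying coordinates are irrelevant; they are required
   to be [false] so that each subcube has exactly one code. *)
Definition subcube_code (d n : nat) := (d.-tuple 'I_n * vertex n)%type.

Definition is_subcube (d n : nat) (c : subcube_code d n) : bool :=
  sorted ltn (map val c.1) && [forall i in c.1, ~~ c.2 i].

Definition subcube (d n : nat) (c : subcube_code d n) : {set vertex n} :=
  [set x : vertex n | [forall i, (i \notin c.1) ==> (x i == c.2 i)]].

(* On [subcube c] this is the identification with Q_d through the varying
   coordinates. *)
Definition subcube_proj (d n : nat) (c : subcube_code d n) (x : vertex n) :
  vertex d := [ffun k => x (tnth c.1 k)].

Definition subcube_trace (d n : nat) (S : configuration n) (c : subcube_code d n) :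
  configuration d := [set subcube_proj c x | x in S :&: subcube c].

Lemma card_is_subcube (d n : nat) :
  #|[set c : subcube_code d n | is_subcube c]| = ('C(n, d) * 2 ^ (n - d))%N.
Proof.
rewrite -sum1_card.
rewrite (eq_bigl (fun c : subcube_code d n => sorted ltn (map val c.1) &&
   [forall i in c.1, ~~ c.2 i])); last by move=> c; rewrite inE.
rewrite -(pair_big_dep (fun t : d.-tuple 'I_n => sorted ltn (map val t))
  (fun t (x : vertex n) => [forall i in t, ~~ x i]) (fun _ _ => 1%N)) /=.
rewrite -(card_ltn_sorted_tuples d n) -sum_nat_const.
apply: eq_big => [t|t st]; first by rewrite inE.
rewrite sum1_card.
have ut : uniq t.
  rewrite -(map_inj_uniq val_inj).
  by apply: sorted_uniq st; [exact: ltn_trans|exact: ltnn].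
have -> : (n - d)%N = #|[pred i | i \notin t]|.
  rewrite -[n in LHS]card_ord -(cardC [pred i | i \in t]) /=.
  rewrite (card_uniqP ut) size_tuple addKn; apply: eq_card => i; rewrite !inE.
  by [].
rewrite -card_bool -(card_pffun_on false); apply: eq_card => x.
apply/forall_inP/pffun_onP => [xt|[xs _] i it].
  split=> //; apply/fintype.subsetP => i; rewrite !inE.
  by apply: contraL => /xt /negbTE ->.
apply/negP => xi; have : i \in finfun.support_for false x by rewrite inE xi.
by move/(fintype.subsetP xs); rewrite inE it.
Qed.

Definition copy_fraction (R : realType) (d : nat) (H : configuration d)
    (n : nat) (S : configuration n) : R :=
  #|[set c : subcube_code d n | is_subcube c && exact_copy H (subcube_trace S c)]|%:R
  / ('C(n, d) * 2 ^ (n - d))%:R.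

(* The fractions are nonnegative, so the default value 0 does not affect the
   maximum. *)
Definition max_copy_fraction (R : realType) (d : nat) (H : configuration d)
    (n : nat) : R :=
  \big[Num.max/0]_(S : configuration n) copy_fraction R H S.

Definition cube_density (R : realType) (d : nat) (H : configuration d) : R :=
  limn (max_copy_fraction R H).

(* [limn] returns 0 on divergent sequences, so a nonzero value of the density
   entails convergence. *)
Lemma cube_density_cvg (R : realType) (d : nat) (H : configuration d) (l : R) :
  l != 0 -> cube_density R H = l -> (max_copy_fraction R H @ \oo --> l)%classic.
Proof.
move=> l0 Hl; rewrite -Hl; apply: contrapT => /dvgP.
rewrite -/(cube_density R H) Hl => lp; move: l0; rewrite lp.
by rewrite eqxx.
Qed.

Definition W2 : configuration 3 :=
  [set [ffun=> false]; [ffun i : 'I_3 => (i < 2)%N]].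

(* Main.v *)
Require Import Defs.
From mathcomp Require Import all_boot all_order all_fingroup all_algebra.
From mathcomp Require Import all_classical all_reals all_analysis.
From mathcomp Require Import zify ring lra.

(** Call a 3-subcube good for [S] when [S] meets it in a copy of [W2]; it has
    eight vertices, so the proportion of good subcubes is the average over the
    vertices [v] of the proportion of good subcubes among those through [v].

    Upper bound.  It turns out that at every single vertex this proportion is at
    most 3/4, up to an error that vanishes with [n].  A subcube through [v] is a
    triple of directions, and its goodness constrains the set [D] of directions
    [i] with [v + e_i] in [S] and the graph [E] of pairs [i j] with
    [v + e_i + e_j] in [S].  If [v] is in [S], a good triple spans exactly one
    edge of [E], so it is not monochromatic for the 2-colouring of pairs by [E],
    and at most 3/4 of all triples are like this (Goodman's theorem, [goodman]).
    If [v] is not in [S], a good triple has two directions in [D], or one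
    direction in [D] with the opposite pair a non-edge, or no direction in [D]
    and exactly two edges.  Edges outside [D] help the third kind and harm the
    second; [cubic_trade_off] balances the two effects, and the outcome is again
    3/4 ([local_pattern_bound]).  All counts run over ordered triples, with
    repetitions, which makes each of these bounds an exact polynomial inequality
    in [n].

    Lower bound.  Split the coordinates into two halves and let [S] consist of
    the vertices whose number of ones is odd in both halves ([odd_odd]).  In a
    subcube with two directions [a], [b] in one half and one, [g], in the other,
    the parity in the second half determines the coordinate [g], and the parity
    in the first leaves two opposite corners of the square spanned by [a] and
    [b]: a copy of [W2].  Only the triples inside one half fail, and these are
    asymptotically 1/4 of all triples.

    Both estimates are explicit: for [n >= 3] the maximal proportion is within
    12 / (n + 1) of 3/4 ([max_copy_fraction_W2]). *)

Set Implicit Arguments.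
Unset Strict Implicit.
Unset Printing Implicit Defensive.

Import Order.TTheory GRing.Theory Num.Theory.
Import numFieldNormedType.Exports.

Local Open Scope ring_scope.

Local Notation o0 := (ord0 : 'I_3).
Local Notation o1 := (lift ord0 ord0 : 'I_3).
Local Notation o2 := (ord_max : 'I_3).

Lemma forall_ord3 (P : 'I_3 -> Prop) : P o0 -> P o1 -> P o2 -> forall i, P i.
Proof.
move=> p0 p1 p2 [[|[|[|//]]] h].
- by have -> : Ordinal h = o0 by apply/val_inj.
- by have -> : Ordinal h = o1 by apply/val_inj.
- by have -> : Ordinal h = o2 by apply/val_inj.
Qed.

(** * The cube as a vector space over the two-element field *)

Definition vadd n (x y : vertex n) : vertex n := [ffun i => x i (+) y i].
Definition vbase n (i : 'I_n) : vertex n := [ffun j => j == i].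

Lemma vaddC n : commutative (@vadd n).
Proof. by move=> x y; apply/ffunP => i; rewrite !ffunE addbC. Qed.

Lemma vaddA n : associative (@vadd n).
Proof. by move=> x y z; apply/ffunP => i; rewrite !ffunE addbA. Qed.

Lemma vaddKl n (x : vertex n) : involutive (vadd x).
Proof. by move=> y; apply/ffunP => i; rewrite !ffunE addKb. Qed.

Lemma vadd_inj n (x : vertex n) : injective (vadd x).
Proof. exact: inv_inj (vaddKl x). Qed.

Lemma vbase_inj n : injective (@vbase n).
Proof. by move=> i j /ffunP/(_ i); rewrite !ffunE eqxx => /esym/eqP. Qed.

Lemma cube_adjP n (x y : vertex n) :
  reflect (exists i, y = vadd x (vbase i)) (cube_adj x y).
Proof.
apply: (iffP cards1P) => -[i hi]; exists i.
  apply/ffunP => j; move/setP/(_ j): hi; rewrite !inE !ffunE => <-.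
  by case: (x j); case: (y j).
by apply/setP => j; rewrite hi !inE !ffunE; case: (x j); case: (j == i).
Qed.

Lemma exists_perm2 (T : finType) (x y a b : T) :
  x != y -> a != b -> exists s : {perm T}, s x = a /\ s y = b.
Proof.
move=> xy ab; exists (tperm x a * tperm (tperm x a y) b)%g.
rewrite !permM tpermL tpermD ?tpermL //; last by rewrite eq_sym.
by rewrite -{2}[a](tpermL x a) (inj_eq perm_inj) eq_sym.
Qed.

(** Move [z0] to the origin, permute the coordinates, move the origin to [z]:
    this gives every automorphism of the cube. *)
Definition coord_affine n (z0 z : vertex n) (s : {perm 'I_n}) (x : vertex n) :
  vertex n := vadd z [ffun i => vadd z0 x (s^-1%g i)].

Lemma coord_affine_inj n (z0 z : vertex n) s : injective (coord_affine z0 z s).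
Proof.
move=> x y /vadd_inj/ffunP exy; apply: (@vadd_inj _ z0); apply/ffunP => i.
by have := exy (s i); rewrite !(ffunE, permK).
Qed.

Lemma coord_affine_base n (z0 z : vertex n) s i :
  coord_affine z0 z s (vadd z0 (vbase i)) = vadd z (vbase (s i)).
Proof.
rewrite /coord_affine vaddKl; congr vadd; apply/ffunP => j.
by rewrite !ffunE (canF_eq (permKV s)).
Qed.

Lemma coord_affine_aut n (z0 z : vertex n) s :
  cube_aut (perm (@coord_affine_inj n z0 z s)).
Proof.
apply/forallP => x; apply/forallP => y; rewrite /cube_adj !permE /hamming.
rewrite -[X in _ == (X == _)](card_imset _ (@perm_inj _ s)); apply/eqP.
congr (#|pred_of_set _| == _); apply/setP => i; rewrite -{2}[i](permKV s).
rewrite mem_imset ?inE; last exact: perm_inj.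
by rewrite !ffunE !(inj_eq (@addbI _)).
Qed.

(** Seeing the two points of [W2] as neighbours of the vertex 100, rather than
    as points at distance two, turns copies into pairs of neighbours of a common
    vertex: this shape is visibly kept by every automorphism. *)
Lemma W2E : W2 = [set vadd (vbase o0) (vbase i) | i in [set o0; o1]].
Proof.
rewrite imsetU !imset_set1; congr [set _; _]; apply/ffunP => -[[|[|[|//]]] ?];
 by rewrite !ffunE.
Qed.

(** An automorphism keeps adjacency, hence maps the two neighbours of 100 to two
    neighbours of its image.  Conversely the automorphism is a translation
    composed with a permutation that sends the first two coordinates to [a] and
    [b]. *)
Lemma exact_copy_W2P (K : configuration 3) :
  reflect (exists z a b, a != b /\ K = [set vadd z (vbase a); vadd z (vbase b)])
    (exact_copy W2 K).
Proof.
rewrite W2E imsetU !imset_set1.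
apply: (iffP existsP) => [[f /andP[/forallP fa /eqP <-]]|].
  have adj i : cube_adj (f (vbase o0)) (f (vadd (vbase o0) (vbase i))).
    by rewrite (eqP (forallP (fa _) _)); apply/cube_adjP; exists i.
  have /cube_adjP[a ha] := adj o0; have /cube_adjP[b hb] := adj o1.
  exists (f (vbase o0)), a, b; rewrite imsetU !imset_set1 -ha -hb; split => //.
  apply: contra_eq_neq ha => ->; rewrite -hb.
  by rewrite (inj_eq perm_inj) (inj_eq (@vadd_inj _ _)) (inj_eq (@vbase_inj _)).
move=> [z [a [b [ab ->]]]].
have [s [<- <-]] := @exists_perm2 _ o0 o1 a b isT ab.
exists (perm (@coord_affine_inj 3 (vbase o0) z s)).
by rewrite coord_affine_aut imsetU !imset_set1 !permE !coord_affine_base eqxx.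
Qed.

(** The linear map that sends the basis vector [l] of the small cube to the
    direction [tnth t l]; the subcubes with varying coordinates [t] are the
    cosets of its image. *)
Definition embed d n (t : d.-tuple 'I_n) (u : vertex d) : vertex n :=
  [ffun i => [exists l, (tnth t l == i) && u l]].

Lemma embed_tnth d n (t : d.-tuple 'I_n) u l :
  uniq t -> embed t u (tnth t l) = u l.
Proof.
move=> /tuple_uniqP t_inj; rewrite ffunE; apply/existsP/idP => [[k]|ul].
  by case/andP => /eqP/t_inj ->.
by exists l; rewrite eqxx.
Qed.

Lemma embed_out d n (t : d.-tuple 'I_n) u i : i \notin t -> embed t u i = false.
Proof.
move=> it; rewrite ffunE; apply/existsP => -[l /andP[/eqP tl _]].
by rewrite -tl mem_tnth in it.
Qed.

Lemma embed_vbase d n (t : d.-tuple 'I_n) l :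
  embed t (vbase l) = vbase (tnth t l).
Proof.
apply/ffunP => i; rewrite !ffunE; apply/existsP/eqP => [[k]|->].
  by rewrite ffunE => /andP[/eqP<- /eqP->].
by exists l; rewrite ffunE !eqxx.
Qed.

Lemma embed_vadd d n (t : d.-tuple 'I_n) u u' : uniq t ->
  embed t (vadd u u') = vadd (embed t u) (embed t u').
Proof.
move=> ut; apply/ffunP => i; rewrite [RHS]ffunE.
have [/tnthP[l ->]|it] := boolP (i \in t); last by rewrite !embed_out.
by rewrite !embed_tnth // ffunE.
Qed.

Section Subcube.
Variables (d n : nat) (c : subcube_code d n).
Hypothesis c_sub : is_subcube c.

Lemma subcube_uniq : uniq c.1.
Proof.
have /andP[st _] := c_sub; rewrite -(map_inj_uniq val_inj).
by apply: sorted_uniq st; [exact: ltn_trans|exact: ltnn].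
Qed.

Lemma mem_subcubeP (v x : vertex n) : v \in subcube c ->
  reflect (exists u, x = vadd v (embed c.1 u)) (x \in subcube c).
Proof.
rewrite inE => /forallP vc; apply: (iffP idP) => [|[u ->]].
  rewrite inE => /forallP xc.
  exists (vadd (subcube_proj c v) (subcube_proj c x)).
  apply/ffunP => i; rewrite ffunE.
  have [/tnthP[l ->]|it] := boolP (i \in c.1).
    by rewrite embed_tnth ?subcube_uniq // !ffunE addKb.
  by rewrite embed_out // addbF (eqP (implyP (vc i) it)) (eqP (implyP (xc i) it)).
rewrite inE; apply/forallP => i; apply/implyP => it.
by rewrite ffunE embed_out // addbF (implyP (vc i) it).
Qed.

Lemma subcube_projD v u :
  subcube_proj c (vadd v (embed c.1 u)) = vadd (subcube_proj c v) u.
Proof.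
by apply/ffunP => l; rewrite !ffunE -[in RHS](embed_tnth u l subcube_uniq) !ffunE.
Qed.

(** Any vertex of the subcube can serve as the origin when reading its trace. *)
Lemma mem_subcube_trace (S : configuration n) v u : v \in subcube c ->
  (vadd (subcube_proj c v) u \in subcube_trace S c)
  = (vadd v (embed c.1 u) \in S).
Proof.
move=> vc; apply/imsetP/idP => [[x]|hS].
  rewrite inE => /andP[xS /(mem_subcubeP _ vc)[u' ex]].
  by rewrite ex subcube_projD => /vadd_inj ->; rewrite -ex.
exists (vadd v (embed c.1 u)); last by rewrite subcube_projD.
by rewrite inE hS; apply/(mem_subcubeP _ vc); exists u.
Qed.

Lemma mem_subcube_base : c.2 \in subcube c.
Proof. by rewrite inE; apply/forallP => i; apply/implyP. Qed.

Lemma card_subcube : #|subcube c| = (2 ^ d)%N.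
Proof.
have -> : subcube c = [set vadd c.2 (embed c.1 u) | u : vertex d].
  apply/setP => x; apply/(mem_subcubeP _ mem_subcube_base)/imsetP => -[u];
    by [exists u | move=> _ ->; exists u].
rewrite card_imset ?card_ffun ?card_bool ?card_ord // => u u'.
move=> /(congr1 (subcube_proj c)).
by rewrite !subcube_projD => /vadd_inj.
Qed.

End Subcube.

(** * Sums over ordered triples *)

Section TripleSums.
Local Open Scope nat_scope.
Variable I : finType.
Implicit Types (F G : I -> I -> I -> nat) (a : I -> nat) (b : I -> I -> nat).

Definition sum3 F := \sum_i \sum_j \sum_k F i j k.

Lemma eq_sum3 F G : (forall i j k, F i j k = G i j k) -> sum3 F = sum3 G.
Proof. by move=> e; do 3!apply: eq_bigr => ? _; exact: e. Qed.

Lemma leq_sum3 F G : (forall i j k, F i j k <= G i j k) -> sum3 F <= sum3 G.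
Proof. by move=> e; do 3!apply: leq_sum => ? _; exact: e. Qed.

Lemma sum3D F G : sum3 (fun i j k => F i j k + G i j k) = sum3 F + sum3 G.
Proof.
rewrite -big_split; apply: eq_bigr => i _; rewrite -big_split.
by apply: eq_bigr => j _; rewrite -big_split.
Qed.

Lemma sum3_swap12 F : sum3 (fun i j k => F j i k) = sum3 F.
Proof. exact: exchange_big. Qed.

Lemma sum3_swap23 F : sum3 (fun i j k => F i k j) = sum3 F.
Proof. by apply: eq_bigr => i _; apply: exchange_big. Qed.

Lemma sum3_rot F : sum3 (fun i j k => F j k i) = sum3 F.
Proof. by rewrite (sum3_swap12 (fun i j k => F i k j)) sum3_swap23. Qed.

Lemma sum3_rot2 F : sum3 (fun i j k => F k i j) = sum3 F.
Proof. by rewrite (sum3_rot (fun i j k => F j k i)) sum3_rot. Qed.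

Lemma sum3_prod a b :
  sum3 (fun i j k => a i * b j k) = (\sum_i a i) * (\sum_j \sum_k b j k).
Proof.
rewrite big_distrl; apply: eq_bigr => i _; rewrite big_distrr.
by apply: eq_bigr => j _; rewrite big_distrr.
Qed.

Lemma sum2_prod a a' :
  \sum_j \sum_k a j * a' k = (\sum_j a j) * (\sum_k a' k).
Proof. by rewrite big_distrl; apply: eq_bigr => j _; rewrite big_distrr. Qed.

End TripleSums.

Section SymmetricTriples.
Local Open Scope nat_scope.

(** The six orderings of a sorted triple are distinct ordered triples. *)
Lemma sorted_triples_le n (Q : 'I_n -> 'I_n -> 'I_n -> bool) :
  (forall i j k, Q i j k = Q j i k) -> (forall i j k, Q i j k = Q i k j) ->
  6 * #|[set t : 3.-tuple 'I_n | sorted ltn (map val t) &&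
      Q (tnth t o0) (tnth t o1) (tnth t o2)]|
  <= sum3 (fun i j k => Q i j k : nat).
Proof.
move=> Q12 Q23; pose L i j k : nat := (Q i j k && (i < j < k)).
have Lsorted : #|[set t : 3.-tuple 'I_n | sorted ltn (map val t) &&
      Q (tnth t o0) (tnth t o1) (tnth t o2)]| <= sum3 L.
  rewrite /sum3 pair_big pair_big /=.
  pose g (t : 3.-tuple 'I_n) :=
    (tnth t o0, tnth t o1, tnth t o2).
  have g_inj : injective g.
    by move=> s t [e0 e1 e2]; apply: eq_from_tnth; apply: forall_ord3.
  rewrite -(card_imset _ g_inj) -sum1_card big_mkcond leq_sum // => -[[i j] k] _.
  case: ifP => // /imsetP[t]; rewrite inE => /andP[st Qt] [-> -> ->].
  rewrite /= /L Qt /=; move: st.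
  case: t {Qt} => [[|a [|b [|c [|//]]]] //= h].
  by rewrite !(tnth_nth a) /= andbT => ->.
have sym : 6 * sum3 L = sum3 (fun i j k => L i j k + L j k i + L k i j
   + (L j i k + L i k j + L k j i)).
  rewrite !sum3D (sum3_rot L) (sum3_rot2 L) (sum3_swap12 L) (sum3_swap23 L).
  by rewrite (sum3_swap12 (fun i j k => L k i j)) (sum3_rot2 L); lia.
apply: leq_trans (leq_mul (leqnn 6) Lsorted) _; rewrite sym.
apply: leq_sum3 => i j k; rewrite /L.
rewrite (Q23 k j i) (Q12 k i j) (Q23 j k i) (Q12 j i k) (Q23 i k j).
case: (Q i j k) => //=.
by case: (ltngtP i j); case: (ltngtP j k); case: (ltngtP i k); lia.
Qed.
End SymmetricTriples.

(** * The density of good triples at one vertex *)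

Section LocalBound.
Local Open Scope nat_scope.
Variables (I : finType) (E : rel I).
Hypothesis E_sym : symmetric E.

(** Goodman's bound on non-monochromatic triples.  Such a triple has exactly two
    vertices at which an edge meets a non-edge.  There are at most
    [p * q <= (m / 2) ^ 2] such meetings at a vertex with [p] neighbours and [q]
    non-neighbours among the [m] vertices of [M].  [E] may have
    loops, so triples with repeated entries need no separate count. *)
Lemma goodman (M : pred I) :
  4 * sum3 (fun i j k => [&& M i, M j, M k
        & ~~ ((E j k == E i k) && (E i k == E i j))] : nat)
  <= 3 * (\sum_i M i) ^ 3.
Proof.
set m := \sum_i M i.
pose cherry i j k : nat := M i * ((M j && E i j) * (M k && ~~ E i k)).
have cherries : 4 * sum3 cherry <= m * m ^ 2.
  rewrite /sum3 /m !(big_distrr, big_distrl) /=; apply: leq_sum => i _.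
  have -> : \sum_j \sum_k cherry i j k
      = M i * ((\sum_j (M j && E i j)) * (\sum_k (M k && ~~ E i k))).
    rewrite -sum2_prod big_distrr; apply: eq_bigr => j _.
    by rewrite big_distrr.
  have -> : \sum_i M i = \sum_j (M j && E i j) + \sum_k (M k && ~~ E i k).
    by rewrite -big_split; apply: eq_bigr => j _; case: (M j); case: (E i j).
  by case: (M i); rewrite ?mul0n ?mul1n ?muln0 ?nat_AGM2.
have split_nonmono : 2 * sum3 (fun i j k => [&& M i, M j, M k
        & ~~ ((E j k == E i k) && (E i k == E i j))] : nat) <= 6 * sum3 cherry.
  have -> : 6 * sum3 cherry = sum3 (fun i j k =>
      cherry i j k + cherry j k i + cherry k i j
      + (cherry j i k + cherry i k j + cherry k j i)).
    rewrite !sum3D (sum3_rot cherry) (sum3_rot2 cherry) (sum3_swap12 cherry).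
    rewrite (sum3_swap23 cherry) (sum3_swap12 (fun i j k => cherry k i j)).
    by rewrite (sum3_rot2 cherry); lia.
  rewrite mul2n -addnn -sum3D; apply: leq_sum3 => i j k.
  rewrite /cherry (E_sym k i) (E_sym k j) (E_sym j i).
  by case: (M i); case: (M j); case: (M k);
    case: (E j k); case: (E i k); case: (E i j).
by move: cherries; rewrite -expnS; lia.
Qed.

(** What goodness of the subcube spanned by directions [i j k] at a vertex [v]
    implies about the vertices at distance at most two from [v].  The bit [s] tells
    whether [v] is in the configuration, [a b c] whether its neighbours along
    [i j k] are, and [x y z] whether the vertices reached along the pairs
    opposite to [i], [j], [k] are. *)
Definition local_pattern (s a b c x y z : bool) : bool :=
  if s then x + y + z == 1
  else [|| a + b + c == 2,
           (a + b + c == 1) && ((a && ~~ x) || (b && ~~ y) || (c && ~~ z))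
         | (a + b + c == 0) && (x + y + z == 2)].

(** Here [d] directions lie in [D], [m] do not, [e] counts the edges and [t] the
    two-edge triples outside [D].  If [m <= 2 * d], the first bound on [t] is
    absorbed by [12 * (d * e)].  Otherwise take the convex combination of the
    two bounds with weights [2 * d / m] and [1 - 2 * d / m], for which [e] cancels;
    what remains is [3 * d * (d ^ 2 - d * m + m ^ 2) >= 0]. *)
Lemma cubic_trade_off (d m e t : nat) :
  2 * t <= 3 * (m * e) -> 4 * t <= 3 * m ^ 3 ->
  12 * (d * d * m) + 12 * (d * m * m) + 4 * t <= 3 * (d + m) ^ 3 + 12 * (d * e).
Proof.
move=> h1 h2.
have [dm|dm] := leqP m (2 * d).
  have agm : 4 * (d * m) * (d + m) <= (d + m) ^ 2 * (d + m).
    by rewrite leq_mul2r nat_AGM2 orbT.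
  have tde : 4 * t <= 12 * (d * e) by nia.
  by rewrite expnSr; nia.
have [r mE] : exists r, m = 2 * d + r by exists (m - 2 * d); lia.
have {h1}h1 : 2 * d * (4 * t) <= 2 * d * (6 * (m * e)).
  by rewrite leq_mul2l; apply/orP; right; lia.
have {h2}h2 : r * (4 * t) <= r * (3 * m ^ 3) by rewrite leq_mul2l h2 orbT.
have m_gt0 : 0 < m by lia.
have t_le : 4 * t <= 12 * (d * e) + 3 * (r * m ^ 2).
  rewrite -(leq_pmul2l m_gt0) {1}mE mulnDl; apply: leq_trans (leq_add h1 h2) _.
  by rewrite expnS; lia.
by move: t_le; rewrite mE !expnS expn0; nia.
Qed.

(** For [s] true the triples are not monochromatic.  For [s] false they are
    sorted by the number of entries in [D]: [two], [one] and [none]. *)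
Lemma local_pattern_bound (s : bool) (D : pred I) :
  4 * sum3 (fun i j k =>
     local_pattern s (D i) (D j) (D k) (E j k) (E i k) (E i j) : nat)
  <= 3 * #|I| ^ 3.
Proof.
case: s.
  apply: leq_trans (_ : 3 * (\sum_(i : I) 1) ^ 3 <= _); last by rewrite sum1_card.
  apply: leq_trans (goodman xpredT); rewrite leq_mul2l /=; apply: leq_sum3 => i j k.
  by rewrite /=; case: (E j k); case: (E i k); case: (E i j).
pose M i := ~~ D i.
set d := \sum_i D i; set m := \sum_i M i.
pose e := \sum_j \sum_k (M j * M k * E j k).
have -> : #|I| = d + m.
  by rewrite -sum1_card -big_split; apply: eq_bigr => i _; rewrite /M; case: (D i).
pose two i j k : nat := D i * (D j * M k).
pose one i j k : nat := D i * (M j * M k * ~~ E j k).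
pose bad i j k : nat := D i * (M j * M k * E j k).
pose inner i j k : nat := M i * (M j * M k * E j k).
pose none i j k : nat := M i && M j && M k && (E j k + E i k + E i j == 2).
have s2 : sum3 two = d * d * m by rewrite sum3_prod sum2_prod mulnA.
have s1 : sum3 one + d * e = d * m * m.
  rewrite /e -sum3_prod -sum3D -mulnA -sum2_prod -sum3_prod; apply: eq_sum3 => i j k.
  by rewrite /one; case: (E j k); lia.
have s0 : 2 * sum3 none <= 3 * (m * e).
  rewrite -[m * e]sum3_prod -/inner.
  have -> : 3 * sum3 inner = sum3 (fun i j k => inner i j k + inner j i k + inner k i j).
    by rewrite !sum3D (sum3_swap12 inner) (sum3_rot2 inner); lia.
  rewrite mul2n -addnn -sum3D; apply: leq_sum3 => i j k; rewrite /none /inner.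
  by case: (M i); case: (M j); case: (M k);
    case: (E j k); case: (E i k); case: (E i j).
have s0' : 4 * sum3 none <= 3 * m ^ 3.
  apply: leq_trans (goodman M); rewrite leq_mul2l /=; apply: leq_sum3 => i j k.
  by rewrite /none; case: (M i); case: (M j); case: (M k);
    case: (E j k); case: (E i k); case: (E i j).
have split_pattern : sum3 (fun i j k =>
     local_pattern false (D i) (D j) (D k) (E j k) (E i k) (E i j) : nat)
   <= 3 * sum3 two + 3 * sum3 one + sum3 none.
  have -> : 3 * sum3 two + 3 * sum3 one + sum3 none = sum3 (fun i j k =>
      two i j k + two j k i + two k i j + (one i j k + one j i k + one k i j)
      + none i j k).
    rewrite !sum3D (sum3_rot two) (sum3_rot2 two) (sum3_swap12 one).
    by rewrite (sum3_rot2 one); lia.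
  apply: leq_sum3 => i j k; rewrite /two /one /none /M.
  by case: (D i); case: (D j); case: (D k);
    case: (E j k); case: (E i k); case: (E i j).
have := cubic_trade_off d s0 s0'; lia.
Qed.
End LocalBound.

(** * Subcubes that meet a configuration in a copy of W2 *)

Definition W2_codes n (S : configuration n) : {set subcube_code 3 n} :=
  [set c | is_subcube c && exact_copy W2 (subcube_trace S c)].

Definition nbr1 n (S : configuration n) (v : vertex n) (i : 'I_n) : bool :=
  vadd v (vbase i) \in S.
Definition nbr2 n (S : configuration n) (v : vertex n) (i j : 'I_n) : bool :=
  vadd v (vadd (vbase i) (vbase j)) \in S.

Lemma vertex3_eqE (x y : vertex 3) :
  (x == y) = [&& x o0 == y o0, x o1 == y o1 & x o2 == y o2].
Proof.
apply/eqP/and3P => [-> //|[h0 h1 h2]]; apply/ffunP => i; apply/eqP.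
exact: (@forall_ord3 (fun i => x i == y i)).
Qed.

(** The trace consists of [z + e_a] and [z + e_b]; the claim is then a finite
    check over [a], [b] and the position [w] of [z] relative to [v]. *)
Lemma W2_local_pattern n (S : configuration n) (c : subcube_code 3 n) v :
  c \in W2_codes S -> v \in subcube c ->
  let t := tnth c.1 in is_true (
  local_pattern (v \in S) (nbr1 S v (t o0)) (nbr1 S v (t o1)) (nbr1 S v (t o2))
    (nbr2 S v (t o1) (t o2)) (nbr2 S v (t o0) (t o2)) (nbr2 S v (t o0) (t o1))).
Proof.
rewrite inE => /andP[c_sub /exact_copy_W2P[z [a [b [ab Kab]]]]] vc t.
set w := vadd (subcube_proj c v) z.
have inS u : (vadd v (embed c.1 u) \in S)
    = (u == vadd w (vbase a)) || (u == vadd w (vbase b)).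
  rewrite -mem_subcube_trace // Kab !inE /w -!vaddA.
  by rewrite !(inv_eq (vaddKl _)).
(* The vertex [v] itself is reached by flipping one direction twice. *)
have vE : v = vadd v (embed c.1 (vadd (vbase o0) (vbase o0))).
  rewrite embed_vadd ?subcube_uniq // !embed_vbase vaddC.
  by apply/ffunP => i; rewrite !ffunE addbb.
have n2E i j : nbr2 S v (t i) (t j)
    = (vadd v (embed c.1 (vadd (vbase i) (vbase j))) \in S).
  by rewrite embed_vadd ?subcube_uniq // !embed_vbase.
clearbody w; rewrite {1}vE !n2E /nbr1 /t -!embed_vbase !inS !vertex3_eqE !ffunE.
move: (w o0) (w o1) (w o2) => w0 w1 w2; move: a b ab {Kab inS}.
by do 2!apply: forall_ord3 => //; move=> _ /=; case: w0; case: w1; case: w2.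
Qed.

(** Count pairs of a vertex and a subcube of [A] through it: each subcube has 8
    vertices, a subcube through [v] is determined by its varying coordinates,
    and each sorted triple comes from 6 ordered ones; [48 = 8 * 6]. *)
Lemma subcubes_double_count n (A : {set subcube_code 3 n})
    (Q : vertex n -> 'I_n -> 'I_n -> 'I_n -> bool) :
  (forall v i j k, Q v i j k = Q v j i k) ->
  (forall v i j k, Q v i j k = Q v i k j) ->
  (forall c, c \in A -> is_subcube c) ->
  (forall c v, c \in A -> v \in subcube c ->
     Q v (tnth c.1 o0) (tnth c.1 o1) (tnth c.1 o2)) ->
  (48 * #|A| <= \sum_v sum3 (fun i j k => Q v i j k : nat))%N.
Proof.
move=> Q12 Q23 A_sub AQ.
have -> : (48 * #|A|
    = \sum_(v : vertex n) 6 * #|[set c in A | v \in subcube c]|)%N.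
  rewrite -big_distrr -[48%N]/(6 * 8)%N -mulnA; congr muln.
  rewrite mulnC -sum_nat_const.
  under [RHS]eq_bigr => v _ do rewrite -sum1_card.
  rewrite (exchange_big_dep (mem A)) /=; last first.
    by move=> v c _; rewrite inE => /andP[].
  apply: eq_bigr => c cA; rewrite -[8%N]/(2 ^ 3)%N -(card_subcube (A_sub c cA)).
  by rewrite -sum1_card; apply: eq_bigl => v; rewrite [RHS]inE cA.
apply: leq_sum => v _; apply: leq_trans (sorted_triples_le (Q12 v) (Q23 v)).
rewrite leq_mul2l /=; set G := [set c in A | _].
have inG c : c \in G -> [/\ c \in A, is_subcube c & v \in subcube c].
  by rewrite inE => /andP[cA vc]; split=> //; exact: A_sub.
have fst_inj : {in G &, injective (fun c : subcube_code 3 n => c.1)}.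
  move=> [t x] [t' x'] /inG[_ /andP[_ /= fx] vx] /inG[_ /andP[_ /= fx'] vx'] /= tt'.
  rewrite -{}tt' in fx' vx' *.
  congr pair; apply/ffunP => i; have [it|it] := boolP (i \in t).
    rewrite (negbTE (implyP (forallP fx i) it)).
    by rewrite (negbTE (implyP (forallP fx' i) it)).
  move: vx vx'; rewrite !inE => /forallP/(_ i)/implyP/(_ it)/eqP <-.
  by move=> /forallP/(_ i)/implyP/(_ it)/eqP.
rewrite -(card_in_imset fst_inj); apply/subset_leq_card/fintype.subsetP.
move=> _ /imsetP[c + ->].
by case/inG => cA /andP[st _] vc; rewrite inE st; exact: AQ.
Qed.

Lemma card_W2_codes_le n (S : configuration n) :
  (64 * #|W2_codes S| <= 2 ^ n * n ^ 3)%N.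
Proof.
pose Q v i j k := local_pattern (v \in S) (nbr1 S v i) (nbr1 S v j) (nbr1 S v k)
  (nbr2 S v j k) (nbr2 S v i k) (nbr2 S v i j).
have nbr2C v : symmetric (nbr2 S v) by move=> i j; rewrite /nbr2 (vaddC (vbase i)).
have Q12 v i j k : Q v i j k = Q v j i k.
  rewrite /Q (nbr2C v j i) /local_pattern; case: (v \in S);
  by do 3!case: (nbr1 S v _); do 3!case: (nbr2 S v _ _).
have Q23 v i j k : Q v i j k = Q v i k j.
  rewrite /Q (nbr2C v k j) /local_pattern; case: (v \in S);
  by do 3!case: (nbr1 S v _); do 3!case: (nbr2 S v _ _).
have W2sub c : c \in W2_codes S -> is_subcube c by rewrite inE => /andP[].
have count := subcubes_double_count Q12 Q23 W2sub (@W2_local_pattern n S).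
have : (4 * \sum_v sum3 (fun i j k => Q v i j k : nat) <= \sum_(v : vertex n) 3 * n ^ 3)%N.
  rewrite big_distrr; apply: leq_sum => v _ /=.
  by have := local_pattern_bound (nbr2C v) (v \in S) (nbr1 S v); rewrite card_ord.
rewrite sum_nat_const card_ffun card_bool card_ord mulnCA => bound.
by have := leq_trans (leq_mul (leqnn 4) count) bound; lia.
Qed.

Section ParityConfiguration.
Variables (n : nat) (col : 'I_n -> bool).

Definition class_parity (x : vertex n) (b : bool) : bool :=
  \big[addb/false]_(i | col i == b) x i.

Definition odd_odd : configuration n :=
  [set x | class_parity x true && class_parity x false].

Lemma class_parityD x y b :
  class_parity (vadd x y) b = class_parity x b (+) class_parity y b.
Proof. by rewrite -big_split; apply: eq_bigr => i _; rewrite ffunE. Qed.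

Lemma class_parity_embed d (t : d.-tuple 'I_n) u b : uniq t ->
  class_parity (embed t u) b = \big[addb/false]_(l | col (tnth t l) == b) u l.
Proof.
move=> ut; rewrite /class_parity big_mkcond (bigID (mem t)) /=.
rewrite [X in _ (+) X]big1 ?addbF => [|i /embed_out->]; last by case: ifP.
rewrite -big_uniq // big_tuple [RHS]big_mkcond; apply: eq_bigr => l _.
by rewrite embed_tnth.
Qed.

Definition monochromatic (i j k : 'I_n) : bool :=
  (col i == col j) && (col i == col k).

(** A triple that is not monochromatic has two coordinates [al], [be] of one
    colour [ka] and a third one [ga] of the other. *)
Lemma odd_odd_W2 c : is_subcube c ->
  ~~ monochromatic (tnth c.1 o0) (tnth c.1 o1) (tnth c.1 o2) ->
  c \in W2_codes odd_odd.
Proof.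
move=> c_sub; rewrite inE c_sub /monochromatic => nm; apply/exact_copy_W2P.
pose v := vadd c.2 (embed c.1 (subcube_proj c c.2)).
have traceE u : (u \in subcube_trace odd_odd c)
    = (vadd v (embed c.1 u) \in odd_odd).
  have := mem_subcube_trace c_sub odd_odd (vadd (subcube_proj c c.2) u)
    (mem_subcube_base c).
  by rewrite vaddKl => ->; rewrite embed_vadd ?subcube_uniq // vaddA.
move: traceE nm; set a0 := col _; set a1 := col _; set a2 := col _ => traceE nm.
(* [v] is the origin of the subcube, and [p] the parities there. *)
pose p := class_parity v.
pose al := if (a0 == a1) || (a0 == a2) then o0 else o1.
pose be := if a0 == a1 then o1 else o2.
pose ga := if a0 == a1 then o2 else if a0 == a2 then o1 else o0.
pose ka := if (a0 == a1) || (a0 == a2) then a0 else a1.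
(* Coordinate [ga] makes the class of [ga] odd; coordinates [al] and [be] of
   the two points are 01 and 10 if their class is even at [v], and 00 and 11
   if it is odd. *)
exists [ffun l => if l == ga then ~~ p (~~ ka) else (l == al) && p ka], al, be.
split; first by rewrite /al /be; case: (a0) (a1) (a2) nm => -[] [].
apply/setP => u; rewrite traceE !inE !(class_parityD v) -/p.
rewrite !class_parity_embed ?subcube_uniq //.
rewrite !vertex3_eqE !ffunE !(big_mkcond (fun l => _ == _)) !big_ord_recl !big_ord0.
have -> : lift o0 (lift ord0 ord0) = o2 by apply/val_inj.
rewrite -/a0 -/a1 -/a2 /al /be /ga /ka.
case: (a0) (a1) (a2) nm => -[] [] //= _;
by case: (p true); case: (p false); case: (u o0); case: (u o1); case: (u o2).
Qed.

Lemma card_W2_codes_odd_odd :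
  (48 * ('C(n, 3) * 2 ^ (n - 3)) <= 48 * #|W2_codes odd_odd|
     + 2 ^ n * (#|[pred i | col i]| ^ 3 + #|[pred i | ~~ col i]| ^ 3))%N.
Proof.
pose A := [set c : subcube_code 3 n | is_subcube c
  & monochromatic (tnth c.1 o0) (tnth c.1 o1) (tnth c.1 o2)].
have codes_le : ('C(n, 3) * 2 ^ (n - 3) <= #|W2_codes odd_odd| + #|A|)%N.
  rewrite -card_is_subcube; apply: leq_trans (leq_card_setU _ _).
  apply/subset_leq_card/fintype.subsetP => c; rewrite inE => c_sub.
  rewrite inE orbC; case: (boolP (c \in A)) => //=.
  by rewrite inE c_sub; exact: odd_odd_W2.
have mono_le : (48 * #|A|
    <= \sum_(v : vertex n) sum3 (fun i j k => monochromatic i j k : nat))%N.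
  apply: (@subcubes_double_count n A (fun=> monochromatic)).
  - by rewrite /monochromatic => _ i j k; case: (col i); case: (col j); case: (col k).
  - by rewrite /monochromatic => _ i j k; case: (col i); case: (col j); case: (col k).
  - by move=> c; rewrite inE => /andP[].
  - by move=> c v; rewrite inE => /andP[].
rewrite sum_nat_const card_ffun card_bool card_ord in mono_le.
have cube (P : pred 'I_n) : sum3 (fun i j k => P i * (P j * P k))%N = (#|P| ^ 3)%N.
  have -> : #|P| = (\sum_i P i)%N.
    rewrite -sum1_card big_mkcond; apply: eq_bigr => i _.
    by rewrite -[i \in P]/(P i); case: (P i).
  by rewrite sum3_prod sum2_prod !expnS expn0 muln1.
have monoE : sum3 (fun i j k => monochromatic i j k : nat)
    = (#|[pred i | col i]| ^ 3 + #|[pred i | ~~ col i]| ^ 3)%N.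
  rewrite -!cube -sum3D; apply: eq_sum3 => i j k; rewrite /monochromatic /=.
  by case: (col i); case: (col j); case: (col k).
by rewrite -monoE; lia.
Qed.
End ParityConfiguration.

(** * The limit *)

Lemma six_bin3 n : ('C(n.+3, 3) * 6 = n.+3 * (n.+2 * n.+1))%N.
Proof. by rewrite -[6%N]/(3`!) bin_ffact !ffactnS ffactn0 /= muln1. Qed.

(** The proportion of good subcubes is at most [3 * (n + 20) / (4 * (n + 4))],
    which is [3 / 4 + 12 / (n + 4)], in dimension [n + 3]. *)
Lemma W2_codes_upper n (S : configuration n.+3) :
  (4 * n.+4 * #|W2_codes S| <= 3 * (n + 20) * ('C(n.+3, 3) * 2 ^ (n.+3 - 3)))%N.
Proof.
have := card_W2_codes_le S; have := six_bin3 n; rewrite subSS subSS subSS subn0 3!expnSr.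
move: #|_| 'C(_, _) (2 ^ n)%N => G C P hC hG.
have {}hG : (8 * G <= P * n.+3 ^ 3)%N by lia.
have poly : (n.+4 * n.+3 ^ 3 <= (n + 20) * (6 * C))%N.
  by rewrite (mulnC 6) hC !expnS expn0; nia.
have := leq_mul (leqnn P) poly; have := leq_mul (leqnn n.+4) hG.
by nia.
Qed.

Lemma exists_W2_codes_lower n : exists S : configuration n.+3,
  (3 * n.+4 * ('C(n.+3, 3) * 2 ^ (n.+3 - 3)) <=
   4 * n.+4 * #|W2_codes S| + 48 * ('C(n.+3, 3) * 2 ^ (n.+3 - 3)))%N.
Proof.
pose h := n.+3./2; pose col (i : 'I_n.+3) := (i < h)%N.
exists (odd_odd col); have := card_W2_codes_odd_odd col.
have cardh : #|[pred i | col i]| = h.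
  have hn : (h <= n.+3)%N by rewrite /h; lia.
  by rewrite -sum1_card (big_ord_narrow hn) sum1_card card_ord.
have -> : #|[pred i | ~~ col i]| = (n.+3 - h)%N.
  rewrite -[in RHS](card_ord n.+3) -(cardC [pred i | col i]) cardh addKn.
  exact: eq_card.
rewrite cardh; have := six_bin3 n; rewrite subSS subSS subSS subn0 3!expnSr.
have cubes : (4 * (h ^ 3 + (n.+3 - h) ^ 3) <= n.+3 ^ 3 + 3 * n.+3)%N.
  have [b [bE hb]] : exists b, (n.+3 - h = b /\ (b = h \/ b = h.+1))%N.
    by exists (n.+3 - h)%N; rewrite /h; lia.
  have -> : n.+3 = (h + b)%N by rewrite /h in bE *; lia.
  rewrite addKn; case: hb => ->; rewrite !expnS expn0; nia.
move: cubes; move: #|_| 'C(_, _) (2 ^ n)%N => G C P cubes hC hG.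
have {}hG : (24 * (C * P) <= 24 * G + P * (n.+3 ^ 3 + 3 * n.+3))%N.
  by have := leq_mul (leqnn P) cubes; lia.
have poly : (n.+4 * (n.+3 ^ 3 + 3 * n.+3) <= (n + 52) * (6 * C))%N.
  by rewrite (mulnC 6) hC !expnS expn0; nia.
move: {cubes hC} (n.+3 ^ 3 + 3 * n.+3)%N hG poly => X hG poly.
have := leq_mul (leqnn P) poly; have := leq_mul (leqnn n.+4) hG.
lia.
Qed.

Lemma max_copy_fraction_W2 (R : realType) n :
  `|max_copy_fraction R W2 n.+3 - 3 / 4| <= 12 / n.+4%:R :> R.
Proof.
have N_gt0 : 0 < ('C(n.+3, 3) * 2 ^ (n.+3 - 3))%:R :> R.
  by rewrite ltr0n muln_gt0 bin_gt0 expn_gt0.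
have n4_gt0 : 0 < n.+4%:R :> R by rewrite ltr0n.
have fracE (S : configuration n.+3) : copy_fraction R W2 S
   = #|W2_codes S|%:R / ('C(n.+3, 3) * 2 ^ (n.+3 - 3))%:R by [].
rewrite ler_distl; apply/andP; split.
  have [S hS] := exists_W2_codes_lower n.
  apply: le_trans (le_bigmax _ _ S); rewrite fracE ler_pdivlMr //.
  rewrite -(ler_pM2r n4_gt0).
  have -> x : (3 / 4 - 12 / n.+4%:R) * x * n.+4%:R = (3 / 4 * n.+4%:R - 12) * x :> R.
    by field; rewrite gt_eqF.
  by move: hS; rewrite -(ler_nat R) natrD !natrM; lra.
apply: bigmax_le => [|S _].
  by rewrite addr_ge0 // divr_ge0 // ?ltW.
rewrite fracE ler_pdivrMr // -(ler_pM2r n4_gt0).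
have -> x : (3 / 4 + 12 / n.+4%:R) * x * n.+4%:R = (3 / 4 * n.+4%:R + 12) * x :> R.
  by field; rewrite gt_eqF.
have := W2_codes_upper S; rewrite -(ler_nat R) !natrM natrD -(addn4 n) natrD.
by lra.
Qed.

Theorem theorem7p2 (R : realType) : cube_density R W2 = 3 / 4.
Proof.
apply: cvg_lim => //; rewrite -(cvg_shiftn 3) /=.
apply/cvgrPdist_le => e e_gt0; exists (Num.bound (12 / e)) => // n /= n_large.
rewrite distrC addn3; apply: le_trans (max_copy_fraction_W2 R n) _.
rewrite ler_pdivrMr ?ltr0n // mulrC -ler_pdivrMr //.
apply: le_trans (ltW (archi_boundP _)) _; first by rewrite divr_ge0 // ltW.
by rewrite ler_nat; apply: leq_trans n_large _; rewrite -addn4 leq_addr.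
Qed.
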